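(* Let $A_1,A_2,A_3,B_1,B_2,B_3$ be six points of the base plane of the (Heisenberg) model of $\mathbf{Nil}$ geometry. Consider the infinite circular cylinders $\mathcal{C}^i_{A_1A_2A_3}$ through $A_1,A_2,A_3$ and $\mathcal{C}^i_{B_1B_2B_3}$ through $B_1,B_2,B_3$. Let $\overline{a}^f_1$ be a fibre line on $\mathcal{C}^i_{A_1A_2A_3}$ and $\overline{A}_1$ its common point with the base plane. Construct successively the following fibre lines, each with its intersection point with the base plane: \begin{itemize} \item $\overline{b}^f_2$ (with base point $\overline{B}_2$), the fibre line, other than the one through $B_2$, in which $\mathcal{C}^i_{A_1B_2\overline{A}_1}$ intersects $\mathcal{C}^i_{B_1B_2B_3}$; \item $\overline{a}^f_3$ (with base point $\overline{A}_3$), the fibre line, other than the one through $A_3$, in which $\mathcal{C}^i_{B_2A_3\overline{B}_2}$ intersects $\mathcal{C}^i_{A_1A_2A_3}$; \item $\overline{b}^f_1$ (with base point $\overline{B}_1$), the fibre line, other than the one through $B_1$, in which $\mathcal{C}^i_{A_3B_1\overline{A}_3}$ intersects $\mathcal{C}^i_{B_1B_2B_3}$; \item $\overline{a}^f_2$ (with base point $\overline{A}_2$), the fibre line, other than the one through $A_2$, in which $\mathcal{C}^i_{B_1A_2\overline{B}_1}$ intersects $\mathcal{C}^i_{A_1A_2A_3}$; \item $\overline{b}^f_3$ (with base point $\overline{B}_3$), the fibre line, other than the one through $B_3$, in which $\mathcal{C}^i_{A_2B_3\overline{A}_2}$ intersects $\mathcal{C}^i_{B_1B_2B_3}$. \end{itemize}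 Then: \begin{enumerate} \item The fibre line $\overline{a}^f_1$ lies on $\mathcal{C}^i_{B_3A_1\overline{B}_3}$. \item Let $m^f_1,\overline{m}^f_1$ be the two fibre lines in which $\mathcal{C}^i_{A_1B_2\overline{A}_1\overline{B}_2}$ and $\mathcal{C}^i_{A_2B_1\overline{A}_2\overline{B}_1}$ meet, $m^f_2,\overline{m}^f_2$ the two fibre lines in which $\mathcal{C}^i_{A_1B_3\overline{A}_1\overline{B}_3}$ and $\mathcal{C}^i_{A_3B_1\overline{A}_3\overline{B}_1}$ meet, and $m^f_3,\overline{m}^f_3$ the two fibre lines in which $\mathcal{C}^i_{A_3B_2\overline{A}_3\overline{B}_2}$ and $\mathcal{C}^i_{A_2B_3\overline{A}_2\overline{B}_3}$ meet. Then the fibre lines $m^f_1,m^f_2,m^f_3,\overline{m}^f_1,\overline{m}^f_2,\overline{m}^f_3$ all lie on one infinite circular cylinder. \end{enumerate}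
   Context: $\mathbf{Nil}$ geometry (Heisenberg model): the space $\mathbf{R}^3$ with coordinates $(x,y,z)$ and Riemannian metric $ds^2=dx^2+dy^2+(dz-x\,dy)^2$; it is invariant under the $\mathbf{Nil}$ translations $(a,b,c)\mapsto(x+a,\,y+b,\,z+bx+c)$ with parameters $x,y,z\in\mathbf{R}$. $\mathbf{Nil}$ isometries are the isometries of this metric. The base plane is the plane $z=0$; fibre lines are the straight lines parallel to the $z$-axis. For $r>0$, $\mathcal{C}^i(r)$ is the surface ruled by the fibre lines passing through the points of the Euclidean circle of radius $r$ in the base plane centred at the origin. An infinite circular cylinder is an image of some $\mathcal{C}^i(r)$ under a $\mathbf{Nil}$ isometry; in addition, the Euclidean plane formed by the fibre lines through the points of a Euclidean straight line of the base plane is also called an infinite circular cylinder (of infinite radius). For three distinct points $X,Y,Z$ of the base plane, $\mathcal{C}^i_{XYZ}$ denotes the infinite circular cylinder passing through them, i.e. the union of the fibre lines through the points of the Euclidean circle (or straight line, if they are collinear) through $X,Y,Z$; $\mathcal{C}^i_{XYZW}$ denotes an infinite circular cylinder through the four points $X,Y,Z,W$. It is understood that every object named in the construction is well defined: whenever $\mathcal{C}^i_{XYZ}$ is written, $X,Y,Z$ are distinct; whenever two cylinders are intersected, they are different; and the ''other'' intersection fibre lines, and the pairs $m^f_i,\overline{m}^f_i$ of two distinct fibre lines, exist. *)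

(* Defs.v *)
From mathcomp Require Import all_boot all_order all_algebra.
From mathcomp Require Import all_classical all_reals all_analysis.
Import numFieldNormedType.Exports.

Set Implicit Arguments.
Unset Strict Implicit.
Unset Printing Implicit Defensive.

Import Order.TTheory GRing.Theory Num.Theory.
Local Open Scope classical_set_scope.
Local Open Scope ring_scope.

(* A point of the Heisenberg model is ((x, y), z). *)
Notation nil_space R := (R * R * R)%type.

Definition cx (R : realType) (p : nil_space R) : R := p.1.1.
Definition cy (R : realType) (p : nil_space R) : R := p.1.2.
Definition cz (R : realType) (p : nil_space R) : R := p.2.

(* ds^2 = dx^2 + dy^2 + (dz - x dy)^2 at the point p, evaluated on the tangent
   vector v. *)
Definition nil_metric (R : realType) (p v : nil_space R) : R :=
  cx v ^+ 2 + cy v ^+ 2 + (cz v - cx p * cy v) ^+ 2.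

(* Riemannian isometries: diffeomorphisms pulling ds^2 back to itself. Asking
   for plain differentiability of f and of its inverse is enough, since such
   an f preserves the Riemannian distance and so is smooth (Myers-Steenrod). *)
Definition nil_isometry (R : realType) (f : nil_space R -> nil_space R) : Prop :=
  exists g : nil_space R -> nil_space R,
    [/\ cancel f g, cancel g f,
        forall p, differentiable f p,
        forall p, differentiable g p &
        forall p v, nil_metric (f p) ('d f p v) = nil_metric p v].

Definition base_plane {R : realType} : set (nil_space R) := [set p | cz p = 0].

Definition fibre (R : realType) (p : nil_space R) : set (nil_space R) :=
  [set q | cx q = cx p /\ cy q = cy p].

Definition fibre_line (R : realType) (l : set (nil_space R)) : Prop :=
  exists p, l = fibre p.

Definition fibre_foot (R : realType) (l : set (nil_space R)) (P : nil_space R)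
    : Prop :=
  fibre_line l /\ l `&` base_plane = [set P].

Definition ruled (R : realType) (c : set (nil_space R)) : set (nil_space R) :=
  \bigcup_(q in c) fibre q.

Definition base_circle (R : realType) (u v r : R) : set (nil_space R) :=
  [set q | base_plane q /\ (cx q - u) ^+ 2 + (cy q - v) ^+ 2 = r ^+ 2].

Definition base_line (R : realType) (a b c : R) : set (nil_space R) :=
  [set q | base_plane q /\ a * cx q + b * cy q = c].

Definition is_circle (R : realType) (c : set (nil_space R)) : Prop :=
  exists u v r : R, 0 < r /\ c = base_circle u v r.

Definition is_line (R : realType) (l : set (nil_space R)) : Prop :=
  exists a b c : R, (a, b) <> (0, 0) /\ l = base_line a b c.

Definition infinite_circular_cylinder (R : realType) (D : set (nil_space R))
    : Prop :=
  (exists r f, [/\ 0 < r, nil_isometry f & D = f @` ruled (base_circle 0 0 r)])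
  \/ (exists l, is_line l /\ D = ruled l).

(* C^i_{XYZ} and C^i_{XYZW}, for S = {X, Y, Z} or S = {X, Y, Z, W}: the fibre
   lines over the Euclidean circle or straight line through the points of S.
   That curve is unique as soon as S has three distinct points; the result is
   empty when the points of S are not concyclic or collinear. *)
Definition cylinder_through (R : realType) (S : set (nil_space R))
    : set (nil_space R) :=
  \bigcup_(c in [set c | (is_circle c \/ is_line c) /\ S `<=` c]) ruled c.

Definition common_fibre (R : realType) (C D l : set (nil_space R)) : Prop :=
  [/\ C <> D, fibre_line l & l `<=` C `&` D].

Definition other_common_fibre (R : realType) (C D : set (nil_space R))
    (P : nil_space R) (l : set (nil_space R)) : Prop :=
  common_fibre C D l /\ l <> fibre P.

Definition common_fibre_pair (R : realType) (C D m m' : set (nil_space R))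
    : Prop :=
  [/\ common_fibre C D m, common_fibre C D m' & m <> m'].

(* Main.v *)
(* A circle or line of the base plane is the zero set of a form
   F = a (x^2 + y^2) + b x + c y + d, which three of its zeros determine up to
   a factor.  Let al and be be the forms of the
   circles of the A's and of the B's and c12 that of A1 B2 A1'.  Circles through
   B2, B2' form a pencil, so that of B2 A3 B2' is c12 + s be; in the same way
   the next circles are c12 + s be + t al, c12 + (s + u) be + t al and
   mu (c12 + (s + u) be + t al) + la al.  The last one differs from
   mu c12 + (mu t + la) al by a multiple of be, so the latter vanishes at A1,
   A1', B3 and B3'.  All these forms lie in the 3-dimensional space spanned by
   c12, al and be; there the forms H whose zeros contain the intersection of
   two given ones are cut out by one linear equation, and the three equations
   for the pairs m_i, m_i' are linearly dependent (the theorem of Pappus), so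
   they have a common nonzero solution. *)
Require Import Defs.
From HB Require Import structures.
From mathcomp Require Import all_boot all_order all_algebra.
From mathcomp Require Import all_classical all_reals all_analysis.
From mathcomp Require Import ring lra.

Set Implicit Arguments.
Unset Strict Implicit.
Unset Printing Implicit Defensive.

Import Order.TTheory GRing.Theory Num.Theory.
Import numFieldNormedType.Exports.
Local Open Scope classical_set_scope.
Local Open Scope ring_scope.

(** * Circles and lines of the base plane as zero sets of forms *)

Section Circles.
Variable R : realType.
Implicit Types (F G : nil_space R -> R) (p q X Y Z : nil_space R).

(** The form lives on the whole space and ignores [cz], so its zero set is already the ruled
    surface; [a = 0] covers the lines. *)
Definition circle_form F : Prop :=
  exists a b c d : R,
    forall p, F p = a * (cx p ^+ 2 + cy p ^+ 2) + b * cx p + c * cy p + d.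

Definition nonzero F : Prop := exists p, F p <> 0.

Definition zeros F : set (nil_space R) := [set p | F p = 0].

Lemma circle_form_comb F G k l : circle_form F -> circle_form G ->
  circle_form (fun p => k * F p + l * G p).
Proof.
move=> [a [b [c [d EF]]]] [a' [b' [c' [d' EG]]]].
exists (k * a + l * a'), (k * b + l * b'), (k * c + l * c'), (k * d + l * d').
by move=> p; rewrite EF EG; ring.
Qed.

Lemma circle_form_fibre F p q : circle_form F -> fibre p q -> F q = F p.
Proof. by move=> [a [b [c [d EF]]]] [ex ey]; rewrite !EF ex ey. Qed.

Lemma base_plane_eq p q : base_plane p -> base_plane q ->
  cx p = cx q -> cy p = cy q -> p = q.
Proof.
case: p q => [[x y] z] [[x' y'] z']; rewrite /base_plane /cx /cy /cz /=.
by move=> -> -> -> ->.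
Qed.

(* The determinant of the rows (|U|^2, U) for U = Y - X, Z - X, p - X. *)
Definition concyclic_det X Y Z p : R :=
  let ux := cx Y - cx X in let uy := cy Y - cy X in
  let vx := cx Z - cx X in let vy := cy Z - cy X in
  let wx := cx p - cx X in let wy := cy p - cy X in
  (wx ^+ 2 + wy ^+ 2) * (ux * vy - uy * vx)
  - wx * ((ux ^+ 2 + uy ^+ 2) * vy - (vx ^+ 2 + vy ^+ 2) * uy)
  + wy * ((ux ^+ 2 + uy ^+ 2) * vx - (vx ^+ 2 + vy ^+ 2) * ux).

Lemma circle_form_det X Y Z : circle_form (concyclic_det X Y Z).
Proof.
rewrite /concyclic_det.
set ux := cx Y - cx X; set uy := cy Y - cy X.
set vx := cx Z - cx X; set vy := cy Z - cy X.
set A := ux * vy - uy * vx.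
set B := _ * vy - _ * uy; set C := _ * vx - _ * ux.
exists A, (- 2 * A * cx X - B), (- 2 * A * cy X + C),
  (A * (cx X ^+ 2 + cy X ^+ 2) + B * cx X - C * cy X).
by move=> p; rewrite /=; ring.
Qed.

Lemma concyclic_det_vanish X Y Z :
  [/\ concyclic_det X Y Z X = 0, concyclic_det X Y Z Y = 0 &
      concyclic_det X Y Z Z = 0].
Proof. by split; rewrite /concyclic_det; ring. Qed.

Lemma sqr_norm_eq0 (x y : R) : x ^+ 2 + y ^+ 2 = 0 -> x = 0 /\ y = 0.
Proof.
move/eqP; rewrite paddr_eq0 ?sqr_ge0// !sqrf_eq0.
by move=> /andP[/eqP-> /eqP->].
Qed.

(** Put u = Y - X and v = Z - X. If all coefficients vanish, then u / |u|^2 = v / |v|^2: inversion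
    in the unit circle about [X] sends [Y] and [Z] to the same point, hence [Y = Z]. *)
Lemma concyclic_det_nonzero X Y Z :
  base_plane X -> base_plane Y -> base_plane Z ->
  X <> Y -> X <> Z -> Y <> Z -> nonzero (concyclic_det X Y Z).
Proof.
move=> bX bY bZ XY XZ YZ; apply: contrapT => nz.
have z p : concyclic_det X Y Z p = 0.
  by apply: contrapT => h; apply: nz; exists p.
(* At unit distance from [X] along the axes the determinant is its quadratic coefficient plus or
   minus a linear one, so all of them vanish. *)
have := z ((cx X + 1, cy X), 0); have := z ((cx X - 1, cy X), 0).
have := z ((cx X, cy X + 1), 0); have := z ((cx X, cy X - 1), 0).
rewrite /concyclic_det /=.
set ux := cx Y - cx X; set uy := cy Y - cy X.
set vx := cx Z - cx X; set vy := cy Z - cy X.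
set n := ux ^+ 2 + uy ^+ 2; set m := vx ^+ 2 + vy ^+ 2.
rewrite /cx /cy /= => h1 h2 h3 h4.
have e1 : n * vx = m * ux by lra.
have e2 : n * vy = m * uy by lra.
have n0 : n != 0.
  apply/eqP => /sqr_norm_eq0[]; rewrite /ux /uy => h5 h6.
  by apply: XY; apply: base_plane_eq => //; lra.
have m0 : m != 0.
  apply/eqP => /sqr_norm_eq0[]; rewrite /vx /vy => h5 h6.
  by apply: XZ; apply: base_plane_eq => //; lra.
(* Compare the squared norms of the two sides of n v = m u, where n = |u|^2 and m = |v|^2. *)
have e3 : n = m.
  apply: (mulfI (mulf_neq0 n0 m0)).
  have -> : n * m * n = (n * vx) ^+ 2 + (n * vy) ^+ 2 by rewrite /m; ring.
  by rewrite e1 e2 /n; ring.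
move: e1 e2; rewrite -e3 => /(mulfI n0) e1 /(mulfI n0); move: e1.
rewrite /ux /uy /vx /vy => h5 h6.
by apply: YZ; apply: base_plane_eq => //; lra.
Qed.

(** The rows of [Y], [Z], [p], [q] in the determinant are four vectors in dimension three, so they
    satisfy the linear relation whose coefficients are 3 by 3 minors. Since [F X = 0], [F] is a
    linear function of the row; applied to this relation it kills the terms of [Y] and [Z]. *)
Lemma circle_form_unique F X Y Z p q : circle_form F ->
  F X = 0 -> F Y = 0 -> F Z = 0 ->
  F p * concyclic_det X Y Z q = F q * concyclic_det X Y Z p.
Proof.
move=> [a [b [c [d EF]]]].
pose b' := b + 2 * a * cx X; pose c' := c + 2 * a * cy X.
move=> FX.
have E r : F r = a * ((cx r - cx X) ^+ 2 + (cy r - cy X) ^+ 2)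
    + b' * (cx r - cx X) + c' * (cy r - cy X).
  rewrite -[LHS]subr0 -FX !EF /b' /c'; ring.
rewrite !E /concyclic_det /=.
move: (cx Y - cx X) (cy Y - cy X) (cx Z - cx X) (cy Z - cy X) => ux uy vx vy.
move: (cx p - cx X) (cy p - cy X) (cx q - cx X) (cy q - cy X) => px py qx qy.
have gen n m k l : a * n + b' * ux + c' * uy = 0 ->
  a * m + b' * vx + c' * vy = 0 ->
  (a * k + b' * px + c' * py) *
    (l * (ux * vy - uy * vx) - qx * (n * vy - m * uy) + qy * (n * vx - m * ux))
  = (a * l + b' * qx + c' * qy) *
    (k * (ux * vy - uy * vx) - px * (n * vy - m * uy) + py * (n * vx - m * ux)).
  move=> h1 h2; apply/eqP; rewrite -subr_eq0; apply/eqP.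
  transitivity ((a * n + b' * ux + c' * uy) *
      (k * (vx * qy - vy * qx) - px * (m * qy - vy * l)
       + py * (m * qx - vx * l))
    - (a * m + b' * vx + c' * vy) *
      (k * (ux * qy - uy * qx) - px * (n * qy - uy * l)
       + py * (n * qx - ux * l))).
    ring.
  by rewrite h1 h2; ring.
exact: gen.
Qed.

(** Both forms are proportional to [concyclic_det X Y Z], which is nonzero because the points are
    distinct. *)
Lemma zeros_unique F G X Y Z : base_plane X -> base_plane Y -> base_plane Z ->
  X <> Y -> X <> Z -> Y <> Z ->
  circle_form F -> nonzero F -> F X = 0 -> F Y = 0 -> F Z = 0 ->
  circle_form G -> nonzero G -> G X = 0 -> G Y = 0 -> G Z = 0 ->
  zeros F = zeros G.
Proof.
move=> bX bY bZ XY XZ YZ.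
have [p0 /eqP Np0] := concyclic_det_nonzero bX bY bZ XY XZ YZ.
suff main F' : circle_form F' -> nonzero F' ->
    F' X = 0 -> F' Y = 0 -> F' Z = 0 -> zeros F' = zeros (concyclic_det X Y Z).
  by move=> *; rewrite (main F) // (main G).
move=> cF [p1 Fp1] FX FY FZ.
have U p q := circle_form_unique p q cF FX FY FZ.
apply/seteqP; split=> p; rewrite /zeros /= => h.
- have := U p p1; rewrite h mul0r => /esym/eqP; rewrite mulf_eq0.
  by case/orP => /eqP.
- have := U p p0; rewrite h mulr0 => /eqP; rewrite mulf_eq0 (negPf Np0) orbF.
  by move/eqP.
Qed.

Lemma zeros_proportional F G k l : k != 0 -> nonzero F ->
  (forall p, k * F p = l * G p) -> zeros F = zeros G.
Proof.
move=> k0 [p0 F0] E.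
have l0 : l != 0.
  apply/eqP => l0; apply: F0; have /eqP := E p0.
  by rewrite l0 mul0r mulf_eq0 (negPf k0) => /eqP.
apply/seteqP; split=> p; rewrite /zeros /= => h; have /eqP := E p.
- by rewrite h mulr0 eq_sym mulf_eq0 (negPf l0) => /eqP.
- by rewrite h mulr0 mulf_eq0 (negPf k0) => /eqP.
Qed.

Lemma circle_formP (c : set (nil_space R)) : is_circle c \/ is_line c ->
  exists F, [/\ circle_form F, nonzero F & c = base_plane `&` zeros F].
Proof.
case=> [[u [v [r [r0 ->]]]]|[a [b [c0 [ab ->]]]]].
- exists (fun p => (cx p - u) ^+ 2 + (cy p - v) ^+ 2 - r ^+ 2); split.
  + exists 1, (- 2 * u), (- 2 * v), (u ^+ 2 + v ^+ 2 - r ^+ 2) => p; ring.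
  (* At the centre the form equals [- r ^+ 2]. *)
  + exists ((u, v), 0); rewrite /cx /cy /= !subrr => h.
    by have : 0 < r ^+ 2 by [apply: exprn_gt0]; lra.
  + apply/seteqP; split=> p [bp h]; split=> //; move: h; rewrite /zeros /=.
      by move=> ->; rewrite subrr.
    by move/subr0_eq.
- exists (fun p => a * cx p + b * cy p - c0); split.
  + exists 0, a, b, (- c0) => p; ring.
  + apply: contrapT => nz.
    have z p : a * cx p + b * cy p - c0 = 0.
      by apply: contrapT => h; apply: nz; exists p.
    apply: ab; have := z ((0, 0), 0); have := z ((1, 0), 0).
    have := z ((0, 1), 0); rewrite /cx /cy /= => h1 h2 h3.
    by congr (_, _); lra.
  + apply/seteqP; split=> p [bp h]; split=> //; move: h; rewrite /zeros /=.
      by move=> ->; rewrite subrr.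
    by move/subr0_eq.
Qed.

(** Two distinct zeros exclude the degenerate cases: a constant form when [a = 0], an empty or
    one-point circle otherwise. Completing the square gives the centre and the squared radius
    [k]. *)
Lemma zeros_circle_or_line F X Y : circle_form F -> nonzero F ->
  base_plane X -> base_plane Y -> X <> Y -> F X = 0 -> F Y = 0 ->
  is_circle (base_plane `&` zeros F) \/ is_line (base_plane `&` zeros F).
Proof.
move=> [a [b [c [d EF]]]] [p0 F0] bX bY XY.
have [a0|a0] := eqVneq a 0.
  move=> FX FY; right; exists b, c, (- d); split.
    move=> [b0 c0]; apply: F0; move: FX; rewrite !EF a0 b0 c0; lra.
  apply/seteqP; split=> p [bp]; rewrite /zeros /= => h; split=> //.
    by move: h; rewrite EF a0; lra.
  by rewrite /= EF a0; lra.
pose u := - b / (2 * a); pose v := - c / (2 * a).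
have E p : F p / a = (cx p - u) ^+ 2 + (cy p - v) ^+ 2
                       - (u ^+ 2 + v ^+ 2 - d / a).
  by rewrite EF /u /v; field.
move: (u ^+ 2 + v ^+ 2 - d / a) E => k E.
have Z p : F p = 0 <-> (cx p - u) ^+ 2 + (cy p - v) ^+ 2 = k.
  split=> h; first by apply/subr0_eq; rewrite -E h mul0r.
  have /eqP : F p / a = 0 by rewrite E h subrr.
  by rewrite mulf_eq0 invr_eq0 (negPf a0) orbF => /eqP.
move=> /Z kX /Z kY; left; exists u, v, (Num.sqrt k).
have k0 : 0 < k.
  rewrite lt_neqAle -{2}kX addr_ge0 ?sqr_ge0// andbT.
  apply/eqP => k0; apply: XY; move: kX kY; rewrite -k0.
  move=> /sqr_norm_eq0[h1 h2] /sqr_norm_eq0[h3 h4].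
  by apply: base_plane_eq => //; lra.
split; first by rewrite sqrtr_gt0.
by apply/seteqP; split=> p [bp h]; split=> //; move: h;
  rewrite sqr_sqrtr ?ltW// => /Z.
Qed.

Lemma ruled_zeros F : circle_form F -> ruled (base_plane `&` zeros F) = zeros F.
Proof.
move=> cF; apply/seteqP; split=> p.
  by move=> [q [_ qz] pq]; rewrite /zeros /= (circle_form_fibre cF pq).
move=> h; exists ((cx p, cy p), 0) => //; split=> //.
by rewrite /zeros /= -h; apply: (circle_form_fibre cF); split.
Qed.

(** Any circle or line containing [S] shares [X], [Y], [Z] with [F], so the union defining
    [cylinder_through] runs over a single curve. This turns statements on cylinders into statements
    on forms. *)
Lemma cylinder_through_zeros (S : set (nil_space R)) F X Y Z :
  S `<=` base_plane -> S X -> S Y -> S Z -> uniq [:: X; Y; Z] ->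
  circle_form F -> nonzero F -> S `<=` zeros F ->
  cylinder_through S = zeros F.
Proof.
move=> bS SX SY SZ.
rewrite /= !inE !negb_or andbT => /andP[/andP[/eqP XY /eqP XZ] /eqP YZ].
move=> cF nF FS.
apply/seteqP; split.
  move=> p [c [/circle_formP[G [cG nG ->]] Sc]].
  rewrite ruled_zeros// (@zeros_unique G F X Y Z) //;
    try exact: bS; try exact: FS.
  - by have [] := Sc _ SX.
  - by have [] := Sc _ SY.
  - by have [] := Sc _ SZ.
move=> p Fp; exists (base_plane `&` zeros F); last by rewrite ruled_zeros.
split.
  by apply: (zeros_circle_or_line cF nF (bS _ SX) (bS _ SY)) => //; exact: FS.
by move=> q Sq; split; [exact: bS|exact: FS].
Qed.
End Circles.

(** * Nil translations and cylinders over circles with any centre *)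

Section Translations.
Variable R : realType.
Implicit Types (u v : R) (p q : nil_space R).

(** Linear part, and differential at every point, of a Nil translation with first parameter [u]. *)
Definition shear u p : nil_space R := (p.1, p.2 + u * p.1.2).

Lemma shear_is_linear u : linear (shear u).
Proof.
move=> k [[x y] z] [[x' y'] z']; rewrite /shear /=; congr (_, _) => /=.
rewrite /GRing.scale /=; ring.
Qed.

HB.instance Definition _ u :=
  GRing.isLinear.Build R (nil_space R) (nil_space R) _ (shear u)
    (shear_is_linear u).

Lemma continuous_shear u : continuous (shear u).
Proof.
move=> p; apply: (@cvg_pair _ _ _ _ (nbhs p.1) (nbhs (p.2 + u * p.1.2)) _ _ _
  (fun q => q.1) (fun q => q.2 + u * q.1.2)); first exact: cvg_fst.
apply: cvgD; first exact: cvg_snd.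
apply: cvgM; first exact: cvg_cst.
by apply: cvg_comp; [exact: cvg_fst|exact: cvg_snd].
Qed.

(** [t] is kept apart from [u] so that the inverse of the case [t = ((u, v), 0)], whose vertical
    shift is [u * v], has the same shape. *)
Definition translate u t p : nil_space R := shear u p + t.

Lemma is_diff_translate u t p : is_diff p (translate u t) (shear u).
Proof.
have Ds : is_diff p (shear u) (shear u).
  apply: DiffDef; first exact/linear_differentiable/continuous_shear.
  exact/diff_lin/continuous_shear.
rewrite -[X in is_diff _ _ X]addr0.
exact: is_diffD.
Qed.

Lemma translate_isometry u v : nil_isometry (translate u ((u, v), 0)).
Proof.
exists (translate (- u) ((- u, - v), u * v)); split.
- move=> [[x y] z]; rewrite /translate /shear /=; congr (_, _, _) => /=; ring.
- move=> [[x y] z]; rewrite /translate /shear /=; congr (_, _, _) => /=; ring.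
- by move=> p; have [] := is_diff_translate u ((u, v), 0) p.
- by move=> p; have [] := is_diff_translate (- u) ((- u, - v), u * v) p.
move=> p w; have [_ ->] := is_diff_translate u ((u, v), 0) p.
rewrite /nil_metric /translate /shear /cx /cy /cz /=; ring.
Qed.

(** Nil translations permute the fibres and induce Euclidean translations on [(x, y)], so they carry
    the cylinder about the origin to one about any centre. *)
Lemma ruled_circle_cylinder (u v r : R) : 0 < r ->
  infinite_circular_cylinder (ruled (base_circle u v r)).
Proof.
move=> r0; left; exists r, (translate u ((u, v), 0)).
split=> //; first exact: translate_isometry.
have E (a b c : R) p : ruled (base_circle a b c) p <->
    (cx p - a) ^+ 2 + (cy p - b) ^+ 2 = c ^+ 2.
  split; first by move=> [q [_ h] [-> ->]].
  by move=> h; exists ((cx p, cy p), 0).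
apply/seteqP; split=> p.
  (* The witness is the inverse translation applied to [p]. *)
  move/E => h; exists ((cx p - u, cy p - v), cz p - u * (cy p - v)).
    by apply/E; rewrite /cx /cy /= !subr0.
  case: p {h} => [[x y] z]; rewrite /translate /shear /cx /cy /cz /=.
  by congr (_, _, _) => /=; ring.
move=> [q /E h <-]; apply/E; rewrite -h /translate /shear /cx /cy /=; ring.
Qed.

End Translations.

(** * Cylinders through named points, feet of fibres, pencils *)

Section Cylinders.
Variable R : realType.
Implicit Types (F G : nil_space R -> R) (p q X Y Z W : nil_space R).
Implicit Types (l m : set (nil_space R)).

Lemma concyclic_form X Y Z : base_plane X -> base_plane Y -> base_plane Z ->
  uniq [:: X; Y; Z] ->
  exists F, [/\ circle_form F, nonzero F, F X = 0, F Y = 0 & F Z = 0].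
Proof.
move=> bX bY bZ.
rewrite /= !inE !negb_or andbT => /andP[/andP[/eqP XY /eqP XZ] /eqP YZ].
have [d1 d2 d3] := concyclic_det_vanish X Y Z.
exists (concyclic_det X Y Z); split=> //; first exact: circle_form_det.
exact: concyclic_det_nonzero.
Qed.

Lemma cylinder3_zeros F X Y Z : base_plane X -> base_plane Y -> base_plane Z ->
  uniq [:: X; Y; Z] -> circle_form F -> nonzero F ->
  F X = 0 -> F Y = 0 -> F Z = 0 ->
  cylinder_through [set X; Y; Z] = zeros F.
Proof.
move=> bX bY bZ U cF nF FX FY FZ.
apply: (@cylinder_through_zeros _ _ F X Y Z) => //.
- by move=> p [[->|->]|->].
- by left; left.
- by left; right.
- by right.
- by move=> p [[->|->]|->].
Qed.

(** The three distinct points are those of the construction step that produced the circle; they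
    appear as [X], [Y], [Z] or as [Y], [X], [W] according to which of the two families that step
    starts from. *)
Lemma cylinder4_zeros F X Y Z W : base_plane X -> base_plane Y ->
  base_plane Z -> base_plane W ->
  uniq [:: X; Y; Z] \/ uniq [:: Y; X; W] -> circle_form F -> nonzero F ->
  F X = 0 -> F Y = 0 -> F Z = 0 -> F W = 0 ->
  cylinder_through [set X; Y; Z; W] = zeros F.
Proof.
move=> bX bY bZ bW U cF nF FX FY FZ FW.
have bS : [set X; Y; Z; W] `<=` base_plane by move=> p [[[->|->]|->]|->].
have zS : [set X; Y; Z; W] `<=` zeros F by move=> p [[[->|->]|->]|->].
have SX : [set X; Y; Z; W] X by left; left; left.
have SY : [set X; Y; Z; W] Y by left; left; right.
case: U => U.
  by apply: (cylinder_through_zeros bS SX SY _ U) => //; left; right.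
by apply: (cylinder_through_zeros bS SY SX _ U) => //; right.
Qed.

Lemma fibre_refl p : fibre p p. Proof. by []. Qed.

Lemma fibre_footE l P : fibre_foot l P -> l = fibre P /\ base_plane P.
Proof.
move=> [[p ->] E].
have [[ex ey] bP] : (fibre p `&` base_plane) P by rewrite E.
by split=> //; apply/seteqP; split=> q [qx qy]; split; rewrite ?qx ?qy.
Qed.

Lemma foot_in l P F : fibre_foot l P -> l `<=` zeros F -> F P = 0.
Proof. by move=> /fibre_footE[-> _]; apply; exact: fibre_refl. Qed.

Lemma fibre_line_footE l : fibre_line l ->
  exists P, base_plane P /\ l = fibre P.
Proof.
move=> [p ->]; exists ((cx p, cy p), 0); split=> //.
Qed.

Lemma fibre_sub_zeros F p : circle_form F -> F p = 0 -> fibre p `<=` zeros F.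
Proof. by move=> cF Fp q pq; rewrite /zeros /= (circle_form_fibre cF pq). Qed.

(** One step of the chain: [s] is chosen to make the member of the pencil vanish at [W]. If that
    member were the zero form, [F] would be a multiple of [G]. *)
Lemma pencil_member F G W : circle_form F -> circle_form G -> nonzero F ->
  zeros F <> zeros G -> G W <> 0 ->
  exists s H, [/\ circle_form H, nonzero H, H W = 0 &
    forall p, H p = F p + s * G p].
Proof.
move=> cF cG nF FG /eqP GW.
exists (- F W / G W), (fun p => F p + - F W / G W * G p); split=> //.
- have [a [b [c [d E]]]] := circle_form_comb 1 (- F W / G W) cF cG.
  by exists a, b, c, d => p; rewrite -E mul1r.
- apply: contrapT => h; apply: FG.
  apply: (@zeros_proportional _ _ _ 1 (F W / G W)) => //.
  move=> p; have : F p + - F W / G W * G p = 0.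
    by apply: contrapT => h'; apply: h; exists p.
  by rewrite mul1r mulNr mulNr => /subr0_eq.
- by field.
Qed.

Lemma other_common_fibreE (C D : set (nil_space R)) l P :
  other_common_fibre C D P l -> [/\ C <> D, l `<=` C & l `<=` D].
Proof. by move=> [[CD _ lCD] _]; split=> // p /lCD[]. Qed.

End Cylinders.

(** * Linear algebra of coefficient triples *)

Section Pappus.
Variable R : realType.
Implicit Types (F G H : nil_space R -> R) (p q r s v : R * R * R).

Definition dot p q : R := p.1.1 * q.1.1 + p.1.2 * q.1.2 + p.2 * q.2.
(** For independent [p] and [q], the equation [dot r (cross p q) = 0] says that [r] lies in the
    pencil they span. *)
Definition cross p q : R * R * R :=
  (p.1.2 * q.2 - p.2 * q.1.2, p.2 * q.1.1 - p.1.1 * q.2,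
   p.1.1 * q.1.2 - p.1.2 * q.1.1).

Lemma dotC p q : dot p q = dot q p.
Proof. rewrite /dot; ring. Qed.

(** Two homogeneous equations in three unknowns. The cross product solves them; when it is zero, [p]
    and [q] are proportional and a vector orthogonal to a suitable one of them is enough. *)
Lemma exists_orthogonal p q :
  exists2 v, v <> 0 & dot v p = 0 /\ dot v q = 0.
Proof.
have [c0|c0] := eqVneq (cross p q) 0; last first.
  exists (cross p q); first exact/eqP.
  by split; rewrite /dot /cross /=; ring.
have base (r : R * R * R) : exists2 v, v <> 0 & dot v r = 0.
  case: r => [[x y] z].
  have [x0|/eqP x0] := eqVneq x 0.
    exists (1, 0, 0); last by rewrite /dot /= x0; ring.
    by move=> [] /eqP; rewrite oner_eq0.
  exists (- y, x, 0); last by rewrite /dot /=; ring.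
  by case.
have [->|/eqP p0] := eqVneq p 0.
  have [v v0 vq] := base q; exists v => //; split=> //.
  by rewrite /dot /=; ring.
have [v v0 vp] := base p; exists v => //; split=> //.
case: p q v c0 p0 v0 vp => [[p1 p2] p3] [[q1 q2] q3] [[v1 v2] v3].
rewrite /cross /dot /= => -[h1 h2 h3] p0 v0 vp.
have [p10|p10] := eqVneq p1 0; last first.
  apply: (mulfI p10); rewrite mulr0.
  transitivity (q1 * (v1 * p1 + v2 * p2 + v3 * p3) + v2 * (p1 * q2 - p2 * q1)
     - v3 * (p3 * q1 - p1 * q3)); first by ring.
  by rewrite vp h2 h3; ring.
have [p20|p20] := eqVneq p2 0; last first.
  apply: (mulfI p20); rewrite mulr0.
  transitivity (q2 * (v1 * p1 + v2 * p2 + v3 * p3) - v1 * (p1 * q2 - p2 * q1)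
     + v3 * (p2 * q3 - p3 * q2)); first by ring.
  by rewrite vp h1 h3; ring.
have [p30|p30] := eqVneq p3 0; first by case: p0; rewrite p10 p20 p30.
apply: (mulfI p30); rewrite mulr0.
transitivity (q3 * (v1 * p1 + v2 * p2 + v3 * p3) + v1 * (p3 * q1 - p1 * q3)
   - v2 * (p2 * q3 - p3 * q2)); first by ring.
by rewrite vp h1 h2; ring.
Qed.

(** [v] is parallel to the nonzero vector [cross p q]. The proof reads off a nonzero coordinate of
    (r.v) p x q = (r.(p x q)) v + (v.p) r x q - (v.q) r x p. *)
Lemma dot_cross_eq0 p q r v : cross p q <> 0 ->
  dot v p = 0 -> dot v q = 0 -> dot r (cross p q) = 0 -> dot r v = 0.
Proof.
case: p q r v => [[p1 p2] p3] [[q1 q2] q3] [[r1 r2] r3] [[v1 v2] v3].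
rewrite /cross /dot /= => pq vp vq rpq.
have [c1|c1] := eqVneq (p2 * q3 - p3 * q2) 0; last first.
  apply: (mulfI c1); rewrite mulr0.
  transitivity (v1 * (r1 * (p2 * q3 - p3 * q2) + r2 * (p3 * q1 - p1 * q3) +
      r3 * (p1 * q2 - p2 * q1))
    + (v1 * p1 + v2 * p2 + v3 * p3) * (r2 * q3 - r3 * q2)
    - (v1 * q1 + v2 * q2 + v3 * q3) * (r2 * p3 - r3 * p2)); first by ring.
  by rewrite rpq vp vq; ring.
have [c2|c2] := eqVneq (p3 * q1 - p1 * q3) 0; last first.
  apply: (mulfI c2); rewrite mulr0.
  transitivity (v2 * (r1 * (p2 * q3 - p3 * q2) + r2 * (p3 * q1 - p1 * q3) +
      r3 * (p1 * q2 - p2 * q1))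
    + (v1 * p1 + v2 * p2 + v3 * p3) * (r3 * q1 - r1 * q3)
    - (v1 * q1 + v2 * q2 + v3 * q3) * (r3 * p1 - r1 * p3)); first by ring.
  by rewrite rpq vp vq; ring.
have [c3|c3] := eqVneq (p1 * q2 - p2 * q1) 0; last first.
  apply: (mulfI c3); rewrite mulr0.
  transitivity (v3 * (r1 * (p2 * q3 - p3 * q2) + r2 * (p3 * q1 - p1 * q3) +
      r3 * (p1 * q2 - p2 * q1))
    + (v1 * p1 + v2 * p2 + v3 * p3) * (r1 * q2 - r2 * q1)
    - (v1 * q1 + v2 * q2 + v3 * q3) * (r1 * p2 - r2 * p1)); first by ring.
  by rewrite rpq vp vq; ring.
by case: pq; rewrite c1 c2 c3.
Qed.

(** A vanishing cross product makes the coefficient triples, hence the forms, proportional. *)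
Lemma cross_neq0 F G (c : nil_space R -> R * R * R) p q :
  (forall X, F X = dot p (c X)) -> (forall X, G X = dot q (c X)) ->
  nonzero F -> nonzero G -> zeros F <> zeros G -> cross p q <> 0.
Proof.
move=> EF EG nF nG FG; case: p q EF EG => [[p1 p2] p3] [[q1 q2] q3] EF EG.
rewrite /cross /= => -[h1 h2 h3]; apply: FG; apply: esym.
have [p10|p10] := eqVneq p1 0; last first.
  apply: (zeros_proportional (l := q1) p10 nG) => X.
  rewrite EF EG /dot /=; apply/eqP; rewrite -subr_eq0; apply/eqP.
  transitivity ((p1 * q2 - p2 * q1) * (c X).1.2
    - (p3 * q1 - p1 * q3) * (c X).2); first by ring.
  by rewrite h2 h3; ring.
have [p20|p20] := eqVneq p2 0; last first.
  apply: (zeros_proportional (l := q2) p20 nG) => X.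
  rewrite EF EG /dot /=; apply/eqP; rewrite -subr_eq0; apply/eqP.
  transitivity ((p2 * q3 - p3 * q2) * (c X).2
    - (p1 * q2 - p2 * q1) * (c X).1.1); first by ring.
  by rewrite h1 h3; ring.
apply: (zeros_proportional (k := p3) (l := q3) _ nG) => [|X].
  apply/eqP => p30; case: nF => X; apply.
  by rewrite EF p10 p20 p30 /dot /=; ring.
rewrite EF EG /dot /=; apply/eqP; rewrite -subr_eq0; apply/eqP.
transitivity ((p3 * q1 - p1 * q3) * (c X).1.1
  - (p2 * q3 - p3 * q2) * (c X).1.2); first by ring.
by rewrite h1 h2; ring.
Qed.

(** The condition on [r] puts [H] in the pencil of [F] and [G], so [H] vanishes at their common
    zeros. It is linear in [r], which lets three pairs be treated at once. *)
Lemma common_pair_zeros F G H (c : nil_space R -> R * R * R) p q r m m' :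
  (forall X, F X = dot p (c X)) -> (forall X, G X = dot q (c X)) ->
  (forall X, H X = dot r (c X)) ->
  nonzero F -> nonzero G -> dot r (cross p q) = 0 ->
  common_fibre_pair (zeros F) (zeros G) m m' ->
  m `<=` zeros H /\ m' `<=` zeros H.
Proof.
move=> EF EG EH nF nG rpq [[FG _ mFG] [_ _ mFG'] _].
have pq := cross_neq0 EF EG nF nG FG.
have main X : F X = 0 -> G X = 0 -> H X = 0.
  rewrite EF EG EH dotC (dotC q) => h1 h2.
  exact: dot_cross_eq0 pq h1 h2 rpq.
by split=> X; [move=> /mFG|move=> /mFG'] => -[]; exact: main.
Qed.

End Pappus.

(** The feet of the two fibres are distinct zeros, which makes the base curve a genuine circle or
    line. *)
Lemma zeros_cylinder (R : realType) (F : nil_space R -> R)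
    (l l' : set (nil_space R)) :
  circle_form F -> nonzero F -> fibre_line l -> fibre_line l' -> l <> l' ->
  l `<=` zeros F -> l' `<=` zeros F -> infinite_circular_cylinder (zeros F).
Proof.
move=> cF nF /fibre_line_footE[X [bX ->]] /fibre_line_footE[Y [bY ->]] XY FX FY.
have nXY : X <> Y by move=> e; apply: XY; rewrite e.
have := zeros_circle_or_line cF nF bX bY nXY (FX _ (fibre_refl X))
  (FY _ (fibre_refl Y)).
case=> [[u [v [r [r0 E]]]]|lE].
  by rewrite -(ruled_zeros cF) E; exact: ruled_circle_cylinder.
by right; exists (base_plane `&` zeros F); rewrite ruled_zeros.
Qed.

(** * The chain of circles, its closure, and the common cylinder *)

Theorem theorem3p8 (R : realType)
  (A1 A2 A3 B1 B2 B3 : nil_space R)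
  (a1' a2' a3' b1' b2' b3' : set (nil_space R))
  (A1' A2' A3' B1' B2' B3' : nil_space R)
  (hA1 : base_plane A1) (hA2 : base_plane A2) (hA3 : base_plane A3)
  (hB1 : base_plane B1) (hB2 : base_plane B2) (hB3 : base_plane B3)
  (hA : uniq [:: A1; A2; A3]) (hB : uniq [:: B1; B2; B3])
  (fA1 : fibre_foot a1' A1')
  (ha1 : a1' `<=` cylinder_through [set A1; A2; A3])
  (d1 : uniq [:: A1; B2; A1']) (fB2 : fibre_foot b2' B2')
  (hb2 : other_common_fibre (cylinder_through [set A1; B2; A1'])
           (cylinder_through [set B1; B2; B3]) B2 b2')
  (d2 : uniq [:: B2; A3; B2']) (fA3 : fibre_foot a3' A3')
  (ha3 : other_common_fibre (cylinder_through [set B2; A3; B2'])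
           (cylinder_through [set A1; A2; A3]) A3 a3')
  (d3 : uniq [:: A3; B1; A3']) (fB1 : fibre_foot b1' B1')
  (hb1 : other_common_fibre (cylinder_through [set A3; B1; A3'])
           (cylinder_through [set B1; B2; B3]) B1 b1')
  (d4 : uniq [:: B1; A2; B1']) (fA2 : fibre_foot a2' A2')
  (ha2 : other_common_fibre (cylinder_through [set B1; A2; B1'])
           (cylinder_through [set A1; A2; A3]) A2 a2')
  (d5 : uniq [:: A2; B3; A2']) (fB3 : fibre_foot b3' B3')
  (hb3 : other_common_fibre (cylinder_through [set A2; B3; A2'])
           (cylinder_through [set B1; B2; B3]) B3 b3')
  (d6 : uniq [:: B3; A1; B3']) :
  a1' `<=` cylinder_through [set B3; A1; B3']
  /\ (forall m1 m1' m2 m2' m3 m3' : set (nil_space R),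
      common_fibre_pair (cylinder_through [set A1; B2; A1'; B2'])
        (cylinder_through [set A2; B1; A2'; B1']) m1 m1' ->
      common_fibre_pair (cylinder_through [set A1; B3; A1'; B3'])
        (cylinder_through [set A3; B1; A3'; B1']) m2 m2' ->
      common_fibre_pair (cylinder_through [set A3; B2; A3'; B2'])
        (cylinder_through [set A2; B3; A2'; B3']) m3 m3' ->
      exists D : set (nil_space R), infinite_circular_cylinder D /\
        m1 `|` m2 `|` m3 `|` m1' `|` m2' `|` m3' `<=` D).

Proof.
have [a1E bA1'] := fibre_footE fA1.
have [_ bA2'] := fibre_footE fA2; have [_ bA3'] := fibre_footE fA3.
have [_ bB1'] := fibre_footE fB1; have [_ bB2'] := fibre_footE fB2.
have [_ bB3'] := fibre_footE fB3.
have [al [cal nal al1 al2 al3]] := concyclic_form hA1 hA2 hA3 hA.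
have [be [cbe nbe be1 be2 be3]] := concyclic_form hB1 hB2 hB3 hB.
have EA := cylinder3_zeros hA1 hA2 hA3 hA cal nal al1 al2 al3.
have EB := cylinder3_zeros hB1 hB2 hB3 hB cbe nbe be1 be2 be3.
rewrite EA in ha1 ha2 ha3; rewrite EB in hb1 hb2 hb3.
have al1' : al A1' = 0 := foot_in fA1 ha1.
have [n12 b2c b2be] := other_common_fibreE hb2.
have [n32 a3c a3al] := other_common_fibreE ha3.
have [n31 b1c b1be] := other_common_fibreE hb1.
have [n21 a2c a2al] := other_common_fibreE ha2.
have [n23 b3c b3be] := other_common_fibreE hb3.
have be2' : be B2' = 0 := foot_in fB2 b2be.
have be1' : be B1' = 0 := foot_in fB1 b1be.
have be3' : be B3' = 0 := foot_in fB3 b3be.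
have al3' : al A3' = 0 := foot_in fA3 a3al.
have al2' : al A2' = 0 := foot_in fA2 a2al.
have [c12 [cc12 nc12 c12A1 c12B2 c12A1']] := concyclic_form hA1 hB2 bA1' d1.
have E12 := cylinder3_zeros hA1 hB2 bA1' d1 cc12 nc12 c12A1 c12B2 c12A1'.
have c12be : zeros c12 <> zeros be by rewrite -E12.
have c12B2' : c12 B2' = 0 by apply: (foot_in fB2); rewrite -E12.
(* If [A3] lay on the circle of the B's, that circle would be the one through [B2], [A3], [B2']; it
   would then contain [A3'] and be the one through [A3], [B1], [A3'] too, against [n31]. The same
   argument, moved along the chain, gives [alB1] and [beA2]. *)
have beA3 : be A3 <> 0.
  move=> h; apply: n31; apply: (cylinder3_zeros hA3 hB1 bA3' d3) => //.
  by apply: (foot_in fA3); rewrite -(cylinder3_zeros hB2 hA3 bB2' d2 cbe nbe).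
have [s [c32 [cc32 nc32 c32A3 c32E]]] :=
  pencil_member cc12 cbe nc12 c12be beA3.
have c32B2 : c32 B2 = 0 by rewrite c32E c12B2 be2; ring.
have c32B2' : c32 B2' = 0 by rewrite c32E c12B2' be2'; ring.
have E32 := cylinder3_zeros hB2 hA3 bB2' d2 cc32 nc32 c32B2 c32A3 c32B2'.
have c32al : zeros c32 <> zeros al by rewrite -E32.
have c32A3' : c32 A3' = 0 by apply: (foot_in fA3); rewrite -E32.
have alB1 : al B1 <> 0.
  move=> h; apply: n21; apply: (cylinder3_zeros hB1 hA2 bB1' d4) => //.
  by apply: (foot_in fB1); rewrite -(cylinder3_zeros hA3 hB1 bA3' d3 cal nal).
have [t [c31 [cc31 nc31 c31B1 c31E]]] :=
  pencil_member cc32 cal nc32 c32al alB1.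
have c31A3 : c31 A3 = 0 by rewrite c31E c32A3 al3; ring.
have c31A3' : c31 A3' = 0 by rewrite c31E c32A3' al3'; ring.
have E31 := cylinder3_zeros hA3 hB1 bA3' d3 cc31 nc31 c31A3 c31B1 c31A3'.
have c31be : zeros c31 <> zeros be by rewrite -E31.
have c31B1' : c31 B1' = 0 by apply: (foot_in fB1); rewrite -E31.
have beA2 : be A2 <> 0.
  move=> h; apply: n23; apply: (cylinder3_zeros hA2 hB3 bA2' d5) => //.
  by apply: (foot_in fA2); rewrite -(cylinder3_zeros hB1 hA2 bB1' d4 cbe nbe).
have [u [c21 [cc21 nc21 c21A2 c21E]]] :=
  pencil_member cc31 cbe nc31 c31be beA2.
have c21B1 : c21 B1 = 0 by rewrite c21E c31B1 be1; ring.
have c21B1' : c21 B1' = 0 by rewrite c21E c31B1' be1'; ring.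
have E21 := cylinder3_zeros hB1 hA2 bB1' d4 cc21 nc21 c21B1 c21A2 c21B1'.
have c21al : zeros c21 <> zeros al by rewrite -E21.
have c21A2' : c21 A2' = 0 by apply: (foot_in fA2); rewrite -E21.
(* B3 may lie on the circle of the A's, in which case mu = 0. *)
pose la := - c21 B3; pose mu := al B3.
pose c23 p := la * al p + mu * c21 p.
have cc23 : circle_form c23 := circle_form_comb la mu cal cc21.
have c23A2 : c23 A2 = 0 by rewrite /c23 al2 c21A2; ring.
have c23A2' : c23 A2' = 0 by rewrite /c23 al2' c21A2'; ring.
have c23B3 : c23 B3 = 0 by rewrite /c23 /la /mu; ring.
(* If [c23] vanished identically, then for [mu != 0] [c21] would be a multiple of [al]; for [mu = 0]
   also [la = 0], so [al] and [c21] would share the zeros [A2], [B3], [A2']. Either way [c21al]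
   fails. *)
have nc23 : nonzero c23.
  apply: contrapT => h; apply: c21al.
  have z p : la * al p + mu * c21 p = 0.
    by apply: contrapT => h'; apply: h; exists p.
  have [mu0|mu0] := eqVneq mu 0; last first.
    apply: (zeros_proportional (l := - la) mu0 nc21) => p; have := z p; lra.
  have c21B3 : c21 B3 = 0.
    have [p /eqP alp] := nal; have /eqP := z p.
    rewrite mu0 mul0r addr0 mulf_eq0 (negPf alp) orbF /la oppr_eq0.
    by move/eqP.
  by rewrite -(cylinder3_zeros hA2 hB3 bA2' d5 cal nal)//
     (cylinder3_zeros hA2 hB3 bA2' d5 cc21 nc21).
have E23 := cylinder3_zeros hA2 hB3 bA2' d5 cc23 nc23 c23A2 c23B3 c23A2'.
have c23B3' : c23 B3' = 0 by apply: (foot_in fB3); rewrite -E23.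
(* Otherwise [al] would vanish at [B2] and [B2'] as well as at [A3], against [n32]. *)
have c12al : zeros c12 <> zeros al.
  move=> h; apply: n32.
  have sub : zeros c12 `<=` zeros al by rewrite h.
  by apply: (cylinder3_zeros hB2 hA3 bB2' d2) => //; exact: sub.
(* [T] is the coefficient of [al] in the expansion of [c23] in [c12], [al], [be]; [c13] drops the
   [be] term. *)
pose T := la + mu * t.
pose c13 p := mu * c12 p + T * al p.
have c13E p : c13 p = c23 p - mu * (s + u) * be p.
  by rewrite /c13 /c23 c21E c31E c32E /T; ring.
have cc13 : circle_form c13 := circle_form_comb mu T cc12 cal.
have c13A1 : c13 A1 = 0 by rewrite /c13 c12A1 al1; ring.
have c13A1' : c13 A1' = 0 by rewrite /c13 c12A1' al1'; ring.
have c13B3 : c13 B3 = 0 by rewrite c13E c23B3 be3; ring.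
have c13B3' : c13 B3' = 0 by rewrite c13E c23B3' be3'; ring.
(* For [mu = 0] the forms [c13] and [c23] coincide; otherwise a zero [c13] would make [c12] a
   multiple of [al]. *)
have nc13 : nonzero c13.
  apply: contrapT => h; have z p : c13 p = 0.
    by apply: contrapT => h'; apply: h; exists p.
  have [mu0|mu0] := eqVneq mu 0.
    have [p] := nc23; apply; have := z p.
    by rewrite c13E mu0 !mul0r subr0.
  apply: c12al; apply: (zeros_proportional (l := - T) mu0 nc12) => p.
  by have := z p; rewrite /c13; lra.
split.
  (* [c13] is the form of the circle through [B3], [A1], [B3'], and it vanishes at [A1'], the foot
     of [a1']. *)
  rewrite (cylinder3_zeros hB3 hA1 bB3' d6 cc13 nc13) // a1E.
  exact: fibre_sub_zeros.
rewrite (cylinder4_zeros hA1 hB2 bA1' bB2' (or_introl d1) cc12 nc12) //.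
rewrite (cylinder4_zeros hA2 hB1 bA2' bB1' (or_intror d4) cc21 nc21) //.
rewrite (cylinder4_zeros hA1 hB3 bA1' bB3' (or_intror d6) cc13 nc13) //.
rewrite (cylinder4_zeros hA3 hB1 bA3' bB1' (or_introl d3) cc31 nc31) //.
rewrite (cylinder4_zeros hA3 hB2 bA3' bB2' (or_intror d2) cc32 nc32) //.
rewrite (cylinder4_zeros hA2 hB3 bA2' bB3' (or_introl d5) cc23 nc23) //.
move=> m1 m1' m2 m2' m3 m3' h1 h2 h3.
pose co p := (c12 p, al p, be p).
pose S := s + u.
have D12 p : c12 p = dot (1, 0, 0) (co p) by rewrite /dot /=; ring.
have D32 p : c32 p = dot (1, 0, s) (co p) by rewrite /dot /= c32E; ring.
have D31 p : c31 p = dot (1, t, s) (co p) by rewrite /dot /= c31E c32E; ring.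
have D21 p : c21 p = dot (1, t, S) (co p).
  by rewrite /dot /= c21E c31E c32E /S; ring.
have D23 p : c23 p = dot (mu, T, mu * S) (co p).
  by rewrite /dot /= /c23 c21E c31E c32E /S /T; ring.
have D13 p : c13 p = dot (mu, T, 0) (co p) by rewrite /dot /= /c13; ring.
(* [r] is chosen to meet the conditions of the first two pairs of fibres. *)
have [r r0 [r1 r2]] := exists_orthogonal
  (cross (1, 0, 0) (1, t, S)) (cross (mu, T, 0) (1, t, s)).
(* Pappus: the three cross products are linearly dependent. *)
have r3 : dot r (cross (1, 0, s) (mu, T, mu * S)) = 0.
  transitivity (mu * dot r (cross (1, 0, 0) (1, t, S))
    - dot r (cross (mu, T, 0) (1, t, s))).
    by rewrite /dot /cross /=; ring.
  by rewrite r1 r2; ring.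
pose H p := dot r (co p).
have cH : circle_form H.
  have [a [b [c [d E]]]] := circle_form_comb 1 1
    (circle_form_comb r.1.1 r.1.2 cc12 cal) (circle_form_comb r.2 0 cbe cbe).
  by exists a, b, c, d => p; rewrite -E /H /dot /=; ring.
(* This is the independence of [c12], [al], [be]: a relation involving [be] would make [be] vanish
   at [A1] and [A1'], hence on the circle through [A1], [B2], [A1'], against [n12]; without [be] it
   contradicts [c12al] or [nal]. *)
have nH : nonzero H.
  apply: contrapT => h; have z p : H p = 0.
    by apply: contrapT => h'; apply: h; exists p.
  apply: r0; case: r @H z {r1 r2 r3 cH h} => [[w x] y]; rewrite /dot /= => z.
  have y0 : y = 0.
    apply/eqP/negP => /negP y0; apply: n12.
    apply: (cylinder3_zeros hA1 hB2 bA1' d1) => //; apply: (mulfI y0).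
      by have := z A1; rewrite c12A1 al1; lra.
    by have := z A1'; rewrite c12A1' al1'; lra.
  have w0 : w = 0.
    apply/eqP/negP => /negP w0; apply: c12al.
    apply: (zeros_proportional (l := - x) w0 nc12) => p.
    by have := z p; rewrite y0; lra.
  have [p /eqP alp] := nal; have /eqP := z p.
  rewrite w0 y0 !mul0r add0r addr0 mulf_eq0 (negPf alp) orbF => /eqP ->.
  by [].
have HE p : H p = dot r (co p) by [].
have [m1H m1'H] := common_pair_zeros D12 D21 HE nc12 nc21 r1 h1.
have [m2H m2'H] := common_pair_zeros D13 D31 HE nc13 nc31 r2 h2.
have [m3H m3'H] := common_pair_zeros D32 D23 HE nc32 nc23 r3 h3.
exists (zeros H); split; last by rewrite !subUset.
have [[_ l1 _] [_ l1' _] m1m1'] := h1.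
exact: (zeros_cylinder cH nH l1 l1').
Qed.
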